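(* Let $G$ be a totally disconnected, locally compact group, let $H \le \mathrm{Aut}(G)$ be equicontinuously generated and let $K$ be a closed $H$-invariant subgroup of $G$. Let $\mathcal{V}$ be the set of open $H$-invariant subgroups of $G$. Then the following are equivalent: (i) $H$ acts N-equicontinuously on $G/K$; (ii) $H$ acts N-distally on $G/K$; (iii) there is a neighbourhood $N/K$ of the trivial coset in $G/K$ such that, given $x,y \in N/K$, if $\overline{Hx}$ is compact and $x \in \overline{Hy}$, then $y \in \overline{Hx}$ (orbits and closures taken in $G/K$); (iv) $\{VK/K \mid V \in \mathcal{V}\}$ is a base of neighbourhoods of the trivial coset in $G/K$; (v) $K \ge \mathrm{Res}_G(H)$.
   Context: All topological groups are Hausdorff. $\mathrm{Aut}(G)$ is the group of automorphisms of $G$ as a topological group. A subset $X\subseteq G$ is $H$-invariant if $h(X)=X$ for all $h\in H$. If $K$ is a closed $H$-invariant subgroup, $H$ acts by homeomorphisms on the space of left cosets $G/K$ via $h\cdot xK = h(x)K$. Equicontinuity: the right uniformity on $G/K$ has basic entourages $E_U=\{(xK,yK) : xK\subseteq UyK\}$, $U$ an identity neighbourhood in $G$. For $S\subseteq \mathrm{Aut}(G)$ with $s(K)=K$ for all $s \in S$, a point $xK$ is an equicontinuous point of the action of $S$ on $G/K$ if for every identity neighbourhood $U$ of $G$ there is a neighbourhood $W$ of $xK$ in $G/K$ such that $(s(x)K,s(y)K)\in E_U$ for all $s\in S$ and $yK\in W$. $S$ is equicontinuous on $G$ if every point of $G$ (case $K=\{1\}$) is an equicontinuous point. A group $H\le\mathrm{Aut}(G)$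 is equicontinuously generated if $H=\langle S\rangle$ for some $S=S^{-1}$ that is equicontinuous on $G$. $H$ acts N-equicontinuously on $G/K$ if there is a neighbourhood of the trivial coset consisting of equicontinuous points for the action of $H$. Distality: for a group $H$ acting by homeomorphisms on a Hausdorff space $X$, a pair $(x,y)$ of points is proximal if there are a net $(h_i)$ in $H$ and $z\in X$ with $h_ix\to z$ and $h_iy\to z$. A point $x$ is distal if there is no $y\ne x$ with $(x,y)$ proximal. $H$ acts N-distally on $G/K$ if there is a neighbourhood of the trivial coset consisting of distal points. The discrete residual $\mathrm{Res}_G(H)$ is the intersection of all open $H$-invariant subgroups of $G$. *)

(* Defs.v *)
From HB Require Import structures.
From mathcomp Require Import all_boot all_order all_algebra.
From mathcomp Require Import all_classical topology.

Set Implicit Arguments.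
Unset Strict Implicit.
Unset Printing Implicit Defensive.

Local Open Scope classical_set_scope.
Local Open Scope group_scope.

HB.mixin Record Group_isTopological G of Group G & Topological G := {
  mulg_continuous : continuous (fun xy : G * G => xy.1 * xy.2);
  invg_continuous : continuous (fun x : G => x^-1)
}.

#[short(type="topologicalGroupType")]
HB.structure Definition TopologicalGroup :=
  {G of Group G & Topological G & Group_isTopological G}.

Section subsets_of_groups.
Context {G : groupType}.
Implicit Types A B : set G.

Definition is_subgroup A :=
  [/\ A 1, forall x y, A x -> A y -> A (x * y) & forall x, A x -> A x^-1].

Definition prod_set A B : set G := [set a * b | a in A & b in B].

Definition inv_set A : set G := [set a^-1 | a in A].

Definition generated A : set G := smallest is_subgroup A.

End subsets_of_groups.

(* Automorphisms of G as a topological group. The inverse is carried as data,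
   but it is determined by the underlying map (topAut_ext). *)
Record topAut (G : topologicalGroupType) := TopAut {
  aut_fun :> G -> G;
  aut_inv : G -> G;
  aut_funM : {morph aut_fun : x y / x * y};
  aut_funK : cancel aut_fun aut_inv;
  aut_invK : cancel aut_inv aut_fun;
  aut_continuous : continuous aut_fun;
  aut_inv_continuous : continuous aut_inv
}.

Section topAut_group.
Context {G : topologicalGroupType}.
Implicit Types f g h : topAut G.

Lemma topAut_ext f g : f =1 g -> f = g.
Proof.
case: f g => [f f' fM fK f'K fc f'c] [g g' gM gK g'K gc g'c] /= fg.
have E : f = g by apply/funext.
subst g.
have E' : f' = g' by apply/funext => x; rewrite -{1}(g'K x) fK.
subst g'.
by congr TopAut; exact: Prop_irrelevance.
Qed.

HB.instance Definition _ := gen_eqMixin (topAut G).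
HB.instance Definition _ := gen_choiceMixin (topAut G).

Definition topAut_one : topAut G.
Proof.
apply: (@TopAut G id id) => //; by move=> x; exact: cvg_id.
Defined.

Definition topAut_mul f g : topAut G.
Proof.
apply: (@TopAut G (f \o g) (aut_inv g \o aut_inv f)).
- by move=> x y /=; rewrite !aut_funM.
- by move=> x /=; rewrite !aut_funK.
- by move=> x /=; rewrite !aut_invK.
- by move=> x; apply: continuous_comp; exact: aut_continuous.
- by move=> x; apply: continuous_comp; exact: aut_inv_continuous.
Defined.

Definition topAut_inv f : topAut G.
Proof.
apply: (@TopAut G (aut_inv f) f).
- by move=> x y; rewrite -{1}(aut_invK f x) -{1}(aut_invK f y) -aut_funM aut_funK.
- exact: aut_invK.
- exact: aut_funK.
- exact: aut_inv_continuous.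
- exact: aut_continuous.
Defined.

Fact topAut_mulA : associative topAut_mul.
Proof. by move=> f g h; exact: topAut_ext. Qed.

Fact topAut_mul1 : left_id topAut_one topAut_mul.
Proof. by move=> f; exact: topAut_ext. Qed.

Fact topAut_1mul : right_id topAut_one topAut_mul.
Proof. by move=> f; exact: topAut_ext. Qed.

Fact topAut_mulV : left_inverse topAut_one topAut_inv topAut_mul.
Proof. by move=> f; apply: topAut_ext => x /=; rewrite aut_funK. Qed.

Fact topAut_Vmul : right_inverse topAut_one topAut_inv topAut_mul.
Proof. by move=> f; apply: topAut_ext => x /=; rewrite aut_invK. Qed.

HB.instance Definition _ := isGroup.Build (topAut G)
  topAut_mulA topAut_mul1 topAut_1mul topAut_mulV topAut_Vmul.

Lemma topAut1E (x : G) : (1 : topAut G) x = x. Proof. by []. Qed.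

Lemma topAutME f g (x : G) : (f * g) x = f (g x). Proof. by []. Qed.

Lemma topAutVE f (x : G) : f^-1 x = aut_inv f x. Proof. by []. Qed.

End topAut_group.

Definition invariant_set (G : topologicalGroupType) (H : set (topAut G))
  (X : set G) := forall h, H h -> h @` X = X.

(* G/K as a set of subsets of G. Nothing is required of K in the definition of
   the type; it is the usual coset space when K is a subgroup. *)
Record coset_space (G : groupType) (K : set G) := CosetSpace {
  coset_set :> set G;
  coset_setP : exists x, coset_set = prod_set [set x] K
}.

Section coset_space.
Context {G : groupType} (K : set G).

Definition left_coset (x : G) : coset_space K :=
  @CosetSpace G K (prod_set [set x] K) (ex_intro _ x erefl).

Definition coset_repr (c : coset_space K) : G := sval (cid (coset_setP c)).

Lemma coset_space_ext (c d : coset_space K) : (c : set G) = d -> c = d.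
Proof.
case: c d => [c cP] [d dP] /= E; subst d.
by congr CosetSpace; exact: Prop_irrelevance.
Qed.

Lemma coset_reprK : cancel coset_repr left_coset.
Proof.
by move=> c; apply: coset_space_ext; rewrite /= -(svalP (cid (coset_setP c))).
Qed.

HB.instance Definition _ := isQuotient.Build G (coset_space K) coset_reprK.

End coset_space.

HB.instance Definition _ (G : topologicalGroupType) (K : set G) :=
  Topological.copy (coset_space K) (quotient_topology (coset_space K)).

Lemma coset_openE (G : topologicalGroupType) (K : set G)
  (U : set (coset_space K)) : open U = open (left_coset K @^-1` U).
Proof. by rewrite {1}/open /= /quotient_open unlock. Qed.

Lemma coset_eqP (G : groupType) (K : set G) (x y : G) : is_subgroup K ->
  left_coset K x = left_coset K y <-> K (x^-1 * y).
Proof.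
move=> [K1 KM KV]; split=> [/(congr1 (@coset_set G K)) /= E|Kxy].
  have : prod_set [set y] K y by exists y => //; exists 1; rewrite ?mulg1.
  by rewrite -E => -[_ ->] [k Kk <-]; rewrite mulKg.
apply: coset_space_ext; apply/seteqP; split => z /= [_ ->] [k Kk <-].
  exists y => //; exists ((x^-1 * y)^-1 * k); first by apply: KM => //; exact: KV.
  by rewrite invgM invgK !mulgA mulgV mul1g.
exists x => //; exists (x^-1 * y * k); first exact: KM.
by rewrite !mulgA mulgV mul1g.
Qed.

Section action.
Context {G : topologicalGroupType} (K : set G).

(* Going through a representative makes this total in h and K; for an
   h-invariant subgroup K it is h(xK) = h(x)K (coset_actE). *)
Definition coset_act (h : topAut G) (c : coset_space K) : coset_space K :=
  left_coset K (h (coset_repr c)).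

Lemma coset_actE (h : topAut G) (x : G) : is_subgroup K -> h @` K = K ->
  coset_act h (left_coset K x) = left_coset K (h x).
Proof.
move=> sK hK; apply/coset_eqP => //.
have Kx := (coset_eqP _ _ sK).1 (coset_reprK (left_coset K x)).
have hM := aut_funM h; have h1 : h 1 = 1.
  by apply: (mulgI (h 1)); rewrite -hM !mulg1.
have hV y : h y^-1 = (h y)^-1.
  by apply: (mulgI (h y)); rewrite -hM !mulgV.
by rewrite -hV -hM; have := imageP h Kx; rewrite hK.
Qed.

(* Basic entourages of the right uniformity on G/K, indexed by the
   neighbourhoods U of 1: the pairs (xK, yK) with xK included in UyK. *)
Definition right_entourage (U : set G) : set (coset_space K * coset_space K) :=
  [set cd : coset_space K * coset_space K |
    (cd.1 : set G) `<=` prod_set U cd.2].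

Definition equicontinuous_point (S : set (topAut G)) (c : coset_space K) :=
  forall U : set G, nbhs (1 : G) U ->
    exists2 W : set (coset_space K), nbhs c W &
      forall s d, S s -> W d ->
        right_entourage U (coset_act s c, coset_act s d).

Definition N_equicontinuous (H : set (topAut G)) :=
  exists2 W : set (coset_space K), nbhs (left_coset K 1) W &
    forall c, W c -> equicontinuous_point H c.

Definition coset_orbit (H : set (topAut G)) (c : coset_space K) :
  set (coset_space K) := [set coset_act h c | h in H].

End action.

(* The case K = {1}, with G identified with G/{1}. *)
Definition equicontinuous_on (G : topologicalGroupType) (S : set (topAut G)) :=
  forall x : G, equicontinuous_point S (left_coset [set (1 : G)] x).

Definition equicontinuously_generated (G : topologicalGroupType)
    (H : set (topAut G)) :=
  exists S : set (topAut G),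
    [/\ inv_set S = S, equicontinuous_on S & H = generated S].

Definition directed (I : Type) (le : I -> I -> Prop) :=
  [/\ inhabited I, forall i, le i i,
      forall j i k, le i j -> le j k -> le i k &
      forall i j, exists k, le i k /\ le j k].

(* Eventuality filter of a directed set: a net converges iff its image filter
   does. *)
Definition eventual (I : Type) (le : I -> I -> Prop) : set_system I :=
  [set A | exists i, forall j, le i j -> A j].

Section distal.
Context {A : Type} {X : topologicalType} (act : A -> X -> X) (H : set A).

Definition proximal (x y : X) :=
  exists (I : Type) (le : I -> I -> Prop) (h : I -> A) (z : X),
    [/\ directed le, forall i, H (h i),
        act (h i) x @[i --> eventual le] --> z &
        act (h i) y @[i --> eventual le] --> z].

Definition distal_point (x : X) := ~ exists2 y : X, y <> x & proximal x y.

End distal.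

Definition N_distal (G : topologicalGroupType) (K : set G)
    (H : set (topAut G)) :=
  exists2 W : set (coset_space K), nbhs (left_coset K 1) W &
    forall c, W c -> distal_point (@coset_act G K) H c.

Definition nbhs_base (X : topologicalType) (x : X) (B : set_system X) :=
  (forall V, B V -> nbhs x V) /\
  (forall W, nbhs x W -> exists2 V, B V & V `<=` W).

Definition open_invariant_subgroups (G : topologicalGroupType)
    (H : set (topAut G)) : set_system G :=
  [set V | [/\ is_subgroup V, open V & invariant_set H V]].

Definition Res (G : topologicalGroupType) (H : set (topAut G)) : set G :=
  \bigcap_(V in open_invariant_subgroups H) V.

(* Main.v *)
Require Import Defs.
From HB Require Import structures.
From mathcomp Require Import all_boot all_order all_algebra.
From mathcomp Require Import all_classical topology.

(** Call a subset of G left stable when it is invariant under left translation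
    by a neighbourhood of 1; such a set is clopen, and equicontinuity of the
    generating set S makes [core P] (the points of P which S keeps in P) left
    stable when P is. If P is also H-invariant and contains 1, its stabilizer
    under left translation is an open H-invariant subgroup contained in P; this
    is the source of all the open invariant subgroups below.

    (iii) => (iv): start from P = UK with U a small compact open subgroup and
    iterate [core]. If the iterates become stationary, the stabilizer of the
    last one lies in UK. Otherwise compactness gives a point z of UK outside
    [core UK] whose orbit meets every iterate, so the closure of Hz meets their
    intersection, a closed H-invariant set. A point x there has compact orbit
    closure, but z is not in it, contradicting (iii).

    (ii) => (iii): for x with compact orbit closure X and x in the closure of
    Hy, the limits of H on X and y which map into X form a compact semigroup.
    An idempotent u in it makes y proximal to uy, so y = uy lies in X.

    (v) => (i): for each compact open subgroup U, compactness of U gives an open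
    H-invariant subgroup V with V <= U Res(H). Since Res(H) lies in every such
    V it normalizes V, which controls h(xv)K = h(x)h(v)K uniformly in h. *)

Set Implicit Arguments.
Unset Strict Implicit.
Unset Printing Implicit Defensive.

Local Open Scope classical_set_scope.
Local Open Scope group_scope.

(** * Left stable sets and compact open subgroups *)

Lemma compact_meets_directed (T : topologicalType) (I : Type) (D : set I)
    (F : I -> set T) (C : set T) :
  compact C -> D !=set0 ->
  (forall i j, D i -> D j -> exists2 k, D k & F k `<=` F i `&` F j) ->
  (forall i, D i -> closed (F i)) -> (forall i, D i -> C `&` F i !=set0) ->
  C `&` \bigcap_(i in D) F i !=set0.
Proof.
move=> Cc D0 Fdir Fcl CF.
have PF : ProperFilter (filter_from D (fun i => C `&` F i)).
  apply: filter_from_proper => //; apply: filter_from_filter => // i j Di Dj.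
  have [k Dk Fk] := Fdir _ _ Di Dj; exists k => // x [Cx /Fk[? ?]].
  by split.
have [|x [Cx clx]] := Cc _ PF.
  by have [i Di] := D0; exists i => // x [].
exists x; split=> // i Di; apply: Fcl => // A Ax.
have [|y [[_ Fy] Ay]] := clx (C `&` F i) A _ Ax; first by exists i.
by exists y.
Qed.

Lemma compact_directed_sub_open (T : topologicalType) (I : Type) (D : set I)
    (F : I -> set T) (C O : set T) :
  compact C -> open O -> D !=set0 ->
  (forall i j, D i -> D j -> exists2 k, D k & F k `<=` F i `&` F j) ->
  (forall i, D i -> closed (F i)) -> C `&` \bigcap_(i in D) F i `<=` O ->
  exists2 i, D i & C `&` F i `<=` O.
Proof.
move=> Cc Oo D0 Fdir Fcl CFO; apply: contrapT => /forall2NP CF.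
have [//||i Di|x [[Cx nOx] Fx]] :=
    @compact_meets_directed _ _ D F (C `\` O) _ D0 Fdir.
- by apply: compact_closedI => //; exact: open_closedC.
- exact: Fcl.
- case: (CF i) => // /existsNP[x /not_implyP[[Cx Fx] nO]].
  by exists x.
by apply: nOx; apply: CFO.
Qed.

Section topological_group.
Variable G : topologicalGroupType.
Implicit Types (A C O P U V W : set G) (x y : G).

Lemma lmulg_continuous x : continuous (fun y : G => x * y).
Proof.
move=> y; apply: (@continuous2_cvg _ G G G (nbhs y) _ (fun=> x) id
  (fun a b => a * b)) => //; last exact: cvg_cst.
exact: (@mulg_continuous G (x, y)).
Qed.

Lemma rmulg_continuous x : continuous (fun y : G => y * x).
Proof.
move=> y; apply: (@continuous2_cvg _ G G G (nbhs y) _ id (fun=> x)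
  (fun a b => a * b)) => //; last exact: cvg_cst.
exact: (@mulg_continuous G (y, x)).
Qed.

Lemma nbhs1_inv U : nbhs (1 : G) U -> \forall w \near (1 : G), U w^-1.
Proof. by move=> U1; have := @invg_continuous G 1 U; rewrite invg1; exact. Qed.

Lemma nbhs1_lmul x U : nbhs x U -> \forall w \near (1 : G), U (w * x).
Proof. by move=> Ux; have := @rmulg_continuous x 1 U; rewrite mul1g; exact. Qed.

Lemma nbhs_lmul x U : (\forall w \near (1 : G), U (w * x)) -> nbhs x U.
Proof.
move=> Ux; have : nbhs x (fun y => U (y * x^-1 * x)).
  have := @rmulg_continuous x^-1 x (fun w => U (w * x)).
  by rewrite mulgV; exact.
by apply: filterS => y /=; rewrite -mulgA mulVg mulg1.
Qed.

Lemma nbhs_rmul x U : (\forall w \near (1 : G), U (x * w)) -> nbhs x U.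
Proof.
move=> Ux; have : nbhs x (fun y => U (x * (x^-1 * y))).
  have := @lmulg_continuous x^-1 x (fun w => U (x * w)).
  by rewrite mulVg; exact.
by apply: filterS => y /=; rewrite mulVKg.
Qed.

Lemma nbhs1_mul U : nbhs (1 : G) U ->
  exists2 W, nbhs (1 : G) W & forall a b, W a -> W b -> U (a * b).
Proof.
move=> U1; have := @mulg_continuous G (1, 1) U.
rewrite /= mulg1 => /(_ U1)[[A B] /= [A1 B1] AB].
exists (A `&` B); first exact: filterI.
by move=> a b [Aa _] [_ Bb]; exact: (AB (a, b)).
Qed.

Lemma compact_tube C O : compact C -> open O -> C `<=` O ->
  \forall w \near (1 : G), forall c, C c -> O (w * c).
Proof.
move=> /compact_near_coveringP Cc Oo CO.
apply: (Cc G (nbhs (1 : G)) (fun w c => O (w * c))) => c Cc'.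
have /= := @mulg_continuous G (1, c) O; rewrite mul1g.
move=> /(_ (open_nbhs_nbhs (conj Oo (CO _ Cc'))))[[A B] /= [A1 B1] AB].
by exists (B, A) => // -[b a] [/= Bb Aa]; exact: (AB (a, b)).
Qed.

Lemma compact_nbhs1_conj C U : compact C -> nbhs (1 : G) U ->
  \forall w \near (1 : G), forall c, C c -> U (c * w * c^-1).
Proof.
move=> /compact_near_coveringP Cc U1.
apply: (Cc G (nbhs (1 : G)) (fun w c => U (c * w * c^-1))) => c Cc'.
have /= := @mulg_continuous G (c * 1, c^-1) U; rewrite mulg1 mulgV.
move=> /(_ U1)[[A B] /= [Ac Bc] AB].
have /= := @mulg_continuous G (c, 1) A; rewrite mulg1.
move=> /(_ Ac)[[A' B'] /= [Ac' B1'] AB'].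
exists (A' `&` [set x | B x^-1], B').
  by split=> //; apply: filterI => //; exact: (@invg_continuous G c).
move=> -[x w] [/= [A'x Bx] B'w].
by apply: (AB (x * w, x^-1)); split=> //; exact: (AB' (x, w)).
Qed.

(** A uniform form of openness: one neighbourhood of 1 serves all points of [P]. Equivalently, [P]
    is a union of right cosets of an open subgroup, its stabilizer. *)
Definition left_stable P := \forall w \near (1 : G), forall x, P x -> P (w * x).

Lemma left_stable_open P : left_stable P -> open P.
Proof.
move=> Pst; rewrite openE => x Px; apply: nbhs_lmul.
by move: Pst; rewrite /left_stable; apply: filterS => w; exact.
Qed.

Lemma left_stableC P : left_stable P -> left_stable (~` P).
Proof.
rewrite /left_stable => /nbhs1_inv.
apply: filterS => w Pw x nPx Pwx; apply: nPx.
by rewrite -(mulKg w x); exact: Pw.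
Qed.

Lemma left_stable_closed P : left_stable P -> closed P.
Proof. by move=> /left_stableC/left_stable_open; rewrite openC. Qed.

Lemma left_stableI P Q :
  left_stable P -> left_stable Q -> left_stable (P `&` Q).
Proof.
by rewrite /left_stable; apply: filterS2 => w Pw Qw x [/Pw ? /Qw].
Qed.

Lemma prod_set_stable U A :
  is_subgroup U -> open U -> left_stable (prod_set U A).
Proof.
move=> [U1 UM _] Uo; have : nbhs (1 : G) U by exact: open_nbhs_nbhs.
rewrite /left_stable; apply: filterS => w Uw _ [u Uu [a Aa <-]].
by exists (w * u); [exact: UM|exists a => //; rewrite mulgA].
Qed.

Definition stabilizer P := [set g : G | forall x, P (g * x) <-> P x].

Lemma stabilizer_subgroup P : is_subgroup (stabilizer P).
Proof.
split=> [x|g h Pg Ph x|g Pg x]; first by rewrite mul1g.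
  by rewrite -mulgA; split=> [/Pg/Ph|/Ph/Pg].
by rewrite -(Pg (g^-1 * x)) mulVKg.
Qed.

Lemma nbhs1_stabilizer P : left_stable P -> nbhs (1 : G) (stabilizer P).
Proof.
move=> Ps; have := left_stableC Ps; move: Ps; rewrite /left_stable.
apply: filterS2 => w Pw nPw x.
split=> [Pwx|/Pw//]; apply: contrapT => /nPw; exact.
Qed.

Lemma subgroup_stable V : is_subgroup V -> nbhs (1 : G) V -> left_stable V.
Proof.
move=> [V1 VM VV]; rewrite /left_stable.
by apply: filterS => w Vw x Vx; exact: VM.
Qed.

Lemma stabilizer_open P : left_stable P -> open (stabilizer P).
Proof.
move=> Ps; apply: left_stable_open; apply: subgroup_stable.
  exact: stabilizer_subgroup.
exact: nbhs1_stabilizer.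
Qed.

Lemma stabilizer_sub P : P 1 -> stabilizer P `<=` P.
Proof. by move=> P1 g /(_ 1); rewrite mulg1 => -[_]; exact. Qed.

(** The two halves of a separation are compact and have disjoint open neighbourhoods. Compactness
    puts a relatively clopen [A] inside their union, and cutting [A] down to the side of [x] gives a
    relatively clopen set missing the other half. *)
Lemma quasicomponent_connected C x : hausdorff_space G -> compact C -> C x ->
  connected (\bigcap_(A in [set A | [/\ A x, A `<=` C, closed A &
    closed (C `\` A)]]) A).
Proof.
move=> hG Cc Cx; set F := [set A | _]; set Q := \bigcap_(A in F) A.
have Ccl : closed C by exact: compact_closed.
have FC : F C by split=> //; rewrite setDv; exact: closed0.
have FI A B : F A -> F B -> F (A `&` B).
  move=> [Ax AC Acl CAcl] [Bx BC Bcl CBcl]; split=> //.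
  - by move=> y [/AC].
  - exact: closedI.
  - by rewrite setDIr; exact: closedU.
have Qcl : closed Q by apply: closed_bigI => A [].
have QC : Q `<=` C by move=> y /(_ _ FC).
apply/connectedP => E [E0 QE [sep1 sep2]].
wlog Ex : E E0 QE sep1 sep2 / E false x.
  have : Q x by move=> A [].
  rewrite QE => -[Ex H|Ex H]; first by apply: (H E).
  apply: (H (E \o negb)) => //=; first by rewrite setUC.
  - by rewrite setIC.
  - by rewrite setIC.
have Eor y : Q y -> E false y \/ E true y by rewrite QE.
have EQ b : E b `<=` Q by rewrite QE; case: b => y; [right|left].
have Edis y b : closure (E b) y -> E (~~ b) y -> False.
  move=> cEb Enb; rewrite -[False]/(set0 y).
  by case: b cEb Enb => cEb Enb; [rewrite -sep2|rewrite -sep1].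
have Ecl b : closed (E b).
  move=> y cEy; have /Eor : Q y by apply: Qcl; exact: closureS cEy.
  by case: b cEy => /Edis cEy [] // /cEy.
have Ecpt b : compact (E b).
  by apply: (subclosed_compact (Ecl b) Cc) => y /EQ/QC.
(* Products of two elements of [W] keep [E false] off [E true], so the symmetric [N] below makes
   [O false] and [O true] disjoint. *)
have [|W W1 WM] :=
    nbhs1_mul (compact_tube (Ecpt false) (closed_openC (Ecl true)) _).
  by move=> y Efy; apply: (@Edis y false); exact: subset_closure.
pose N : set G := W `&` [set w | W w^-1].
have N1 : nbhs (1 : G) N by apply: filterI => //; exact: nbhs1_inv.
pose O b := \bigcup_(y in E b) ((fun z => z * y^-1) @^-1` N°).
have Oo b : open (O b).
  apply: bigcup_open => y _; apply: open_comp; last exact: open_interior.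
  by move=> z _; exact: rmulg_continuous.
have EO b : E b `<=` O b.
  by move=> y Ey; exists y => //=; rewrite mulgV; exact: N1.
have Odis y : O false y -> O true y -> False.
  move=> [a Ea /interior_subset[Na _]] [b Eb /interior_subset[_ Nb]].
  apply: (WM _ _ Nb Na a Ea).
  by rewrite invgM invgK -!mulgA mulVg mulg1 mulVg mulg1.
have FF : F !=set0 by exists C.
have [||||A FA AO] := @compact_directed_sub_open _ _ F id C (O false `|` O true)
    Cc _ FF.
- exact: openU.
- by move=> A B FA FB; exists (A `&` B); [exact: FI|].
- by move=> A [].
- by move=> y [_ Qy]; case: (Eor _ Qy) => /EO; [left|right].
have [Ax AC Acl CAcl] := FA.
have AOE : A `&` ~` O true = A `&` O false.
  apply/seteqP; split=> y [Ay Oy]; split=> //; last by move=> /(Odis _ Oy).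
  by have [] := AO y (conj (AC _ Ay) Ay).
have FAO : F (A `&` O false).
  split=> [|y [/AC]//||]; first by split=> //; exact: EO.
    by rewrite -AOE; apply: closedI => //; exact: open_closedC.
  rewrite setDIr; apply: closedU => //.
  by apply: closedI => //; exact: open_closedC.
have [y Ey] := E0 true.
by have [_ Oy] := EQ _ _ Ey _ FAO; apply: (Odis _ Oy); exact: EO.
Qed.
End topological_group.

Section van_dantzig.
Variable G : topologicalGroupType.
Hypotheses (hG : hausdorff_space G) (tdG : totally_disconnected [set: G])
  (lcG : locally_compact [set: G]).

(** Total disconnectedness shrinks the quasicomponent of 1 in a compact neighbourhood [C] to a
    point, so some relatively clopen [A] around 1 lies in the interior of [U] and [C]. It is compact
    and open, hence left stable, and its stabilizer is the subgroup sought. *)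
Lemma van_dantzig (U : set G) : nbhs (1 : G) U ->
  exists V, [/\ is_subgroup V, open V, compact V & V `<=` U].
Proof.
move=> U1; have [C C1' [Cc Ccl]] := lcG (x := 1) I.
have C1 : nbhs (1 : G) C 
  by move: C1'; rewrite /within /=; apply: filterS => y; exact.
pose F := [set A : set G | [/\ A 1, A `<=` C, closed A & closed (C `\` A)]].
have C11 : C 1 by exact: nbhs_singleton.
have FC : F C by split=> //; rewrite setDv; exact: closed0.
have Q1 : \bigcap_(A in F) A `<=` [set 1].
  rewrite -(tdG I) => y Qy; exists (\bigcap_(A in F) A) => //; split=> //.
    by move=> A [].
  exact: quasicomponent_connected.
have [|||||A [A1 AC Acl CAcl] AUC] := @compact_directed_sub_open _ _ F id C
    (U `&` C)° Cc.
- exact: open_interior.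
- by exists C.
- move=> A B [A1 AC Acl CAcl] [B1 BC Bcl CBcl]; exists (A `&` B) => //.
  split=> //.
  + by move=> y [/AC].
  + exact: closedI.
  + by rewrite setDIr; exact: closedU.
- by move=> A [].
- by move=> y [_ /Q1 ->]; apply: filterI.
have AU : A `<=` (U `&` C)° by move=> y Ay; apply: AUC; split=> //; exact: AC.
have Ast : left_stable A.
  apply: compact_tube => //; first exact: (subclosed_compact Acl Cc).
  have -> : A = (U `&` C)° `&` ~` (C `\` A).
    apply/seteqP; split=> y; first by move=> Ay; split; [exact: AU|move=> []].
    move=> [/interior_subset[_ Cy] nCA]; apply: contrapT => nA; exact: nCA.
  by apply: openI; [exact: open_interior|exact: closed_openC].
exists (stabilizer A); split.
- exact: stabilizer_subgroup.
- exact: stabilizer_open.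
- apply: (subclosed_compact _ Cc); last first.
    by move=> y /(stabilizer_sub A1)/AC.
  apply: left_stable_closed; apply: subgroup_stable.
    exact: stabilizer_subgroup.
  exact: nbhs1_stabilizer.
- by move=> y /(stabilizer_sub A1)/AU/interior_subset[].
Qed.
End van_dantzig.

(** * Coset spaces *)

Lemma aut_fun1 (G : topologicalGroupType) (h : topAut G) : h 1 = 1.
Proof. by apply: (mulgI (h 1)); rewrite -aut_funM !mulg1. Qed.

Lemma aut_mulVK (G : topologicalGroupType) (h : topAut G) (x : G) :
  h (h^-1 x) = x.
Proof. by rewrite topAutVE aut_invK. Qed.

Lemma aut_mulKV (G : topologicalGroupType) (h : topAut G) (x : G) :
  h^-1 (h x) = x.
Proof. by rewrite topAutVE aut_funK. Qed.

Section coset_topology.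
Variables (G : topologicalGroupType) (K : set G).
Hypothesis K_group : is_subgroup K.
Local Notation pi := (left_coset K).

Lemma left_coset_continuous : continuous pi.
Proof. by apply/continuousP => A; rewrite coset_openE. Qed.

Lemma left_cosetP (c : coset_space K) : exists x, c = pi x.
Proof. by exists (coset_repr c); rewrite coset_reprK. Qed.

Lemma left_cosetM x k : K k -> pi (x * k) = pi x.
Proof. by move=> Kk; apply/esym/coset_eqP => //; rewrite mulKg. Qed.

Lemma left_coset_open (A : set G) : open A -> open (pi @` A).
Proof.
move=> Ao; rewrite coset_openE.
have -> : pi @^-1` (pi @` A) = \bigcup_(k in K) ((fun x => x * k) @^-1` A).
  apply/seteqP; split=> x.
    move=> [a Aa /esym/coset_eqP-/(_ K_group) Kxa]; exists (x^-1 * a) => //=.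
    by rewrite mulVKg.
  by move=> [k Kk Axk]; exists (x * k) => //; exact: left_cosetM.
apply: bigcup_open => k _; apply: open_comp => // y _; exact: rmulg_continuous.
Qed.

Lemma nbhs_left_coset x (W : set (coset_space K)) :
  nbhs (pi x) W <-> nbhs x (pi @^-1` W).
Proof.
split; first exact: left_coset_continuous.
rewrite nbhsE => -[A [Ao Ax] AW]; rewrite nbhsE; exists (pi @` A).
  by split; [exact: left_coset_open|exists x].
by move=> _ [y /AW Wy <-].
Qed.

(** For a subgroup [K] these are exactly the preimages of subsets of [G/K]. *)
Definition right_invariant (P : set G) := forall x k, K k -> P x -> P (x * k).

Lemma right_invariant_image P x : right_invariant P -> (pi @` P) (pi x) <-> P x.
Proof.
move=> Pr; split=> [[y Py /coset_eqP-/(_ K_group) Kyx]|Px]; last by exists x.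
by rewrite -(mulVKg y x); exact: Pr.
Qed.

Lemma right_invariant_closed P : right_invariant P -> closed P ->
  closed (pi @` P).
Proof.
move=> Pr Pcl; rewrite -openC coset_openE.
have -> : pi @^-1` (~` (pi @` P)) = ~` P.
  by apply/seteqP; split=> x;
    apply: contra_not => /(right_invariant_image x Pr).
exact: closed_openC.
Qed.

Lemma prod_set_right_invariant A : right_invariant (prod_set A K).
Proof.
have [_ KM _] := K_group.
move=> _ k Kk [a Aa [l Kl <-]]; exists a => //; exists (l * k); first exact: KM.
by rewrite mulgA.
Qed.

Lemma image_prod_set A : pi @` prod_set A K = pi @` A.
Proof.
have [K1 _ _] := K_group.
apply/seteqP; split=> c [x].
  by case=> a Aa [k Kk <-] <-; rewrite left_cosetM //; exists a.
by move=> Ax <-; exists x => //; exists x => //; exists 1; rewrite ?mulg1.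
Qed.

Lemma coset_hausdorff : closed K -> hausdorff_space (coset_space K).
Proof.
move=> Kcl c d; have [x ->] := left_cosetP c; have [y ->] := left_cosetP d.
move=> cxy; apply/coset_eqP => //; apply: contrapT => nK.
have : nbhs (x^-1 * y) (~` K).
  by apply: open_nbhs_nbhs; split=> //; exact: closed_openC.
have cc := @mulg_continuous G (x^-1, y).
move=> /cc [[A B] /= [Ax By] AB].
have A'x : nbhs x [set z | A z^-1] by exact: (@invg_continuous G x).
have [||c' [[a Aa ac] [b Bb bc]]] := cxy (pi @` [set z | A z^-1]) (pi @` B).
- apply/nbhs_left_coset; apply: filterS A'x => z; exact: imageP.
- apply/nbhs_left_coset; apply: filterS By => z; exact: imageP.
apply: (AB (a^-1, b)) => //=.
by apply/coset_eqP => //; rewrite ac bc.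
Qed.

Variable H : set (topAut G).
Hypotheses (H_group : is_subgroup H) (K_inv : invariant_set H K).

Lemma invariantP h x : H h -> K x -> K (h x).
Proof. by move=> Hh Kx; rewrite -(K_inv Hh); exact: imageP. Qed.

Lemma coset_act_pi h x : H h -> coset_act h (pi x) = pi (h x).
Proof. by move=> Hh; rewrite coset_actE //; exact: K_inv. Qed.

Lemma coset_actM g h (c : coset_space K) : H g -> H h ->
  coset_act g (coset_act h c) = coset_act (g * h) c.
Proof.
move=> Hg Hh; have [x ->] := left_cosetP c.
have [_ HM _] := H_group.
by rewrite !coset_act_pi //; exact: HM.
Qed.

Lemma coset_act1 (c : coset_space K) : coset_act 1 c = c.
Proof.
by have [x ->] := left_cosetP c; have [H1 _ _] := H_group; rewrite coset_act_pi.
Qed.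

Lemma coset_actKV h (c : coset_space K) : H h ->
  coset_act h^-1 (coset_act h c) = c.
Proof.
have [_ _ HV] := H_group => Hh; rewrite coset_actM ?mulVg ?coset_act1 //.
exact: HV.
Qed.

Lemma coset_act_continuous h : H h -> continuous (@coset_act G K h).
Proof.
move=> Hh; apply/continuousP => A; rewrite !coset_openE => Ao.
have -> : pi @^-1` (@coset_act G K h @^-1` A) = h @^-1` (pi @^-1` A).
  by apply/seteqP; split=> x /=; rewrite coset_act_pi.
by apply: open_comp => // x _; exact: aut_continuous.
Qed.

Lemma closure_orbit_act h c d : H h ->
  closure (coset_orbit H c) d ->
  closure (coset_orbit H c) (@coset_act G K h d).
Proof.
move=> Hh cd B /(coset_act_continuous Hh)/cd[_ [[g Hg <-] /= Bg]].
exists (coset_act h (coset_act g c)); split=> //; exists (h * g).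
  by have [_ HM _] := H_group; exact: HM.
by rewrite coset_actM.
Qed.

Lemma subset_closure_orbit (P : set (coset_space K)) c : closed P ->
  (forall h, H h -> P (coset_act h c)) -> closure (coset_orbit H c) `<=` P.
Proof.
by move=> Pcl PH d cd; apply: Pcl; apply: closureS cd => _ [h Hh <-]; exact: PH.
Qed.

End coset_topology.

(** * Equicontinuity and proximality *)

(** Zorn's lemma gives a minimal nonempty closed subsemigroup [M]. For [a] in [M], minimality forces
    [M a = M], so the [q] in [M] with [q a = a] form a nonempty closed subsemigroup. It is all of
    [M], so [a] is idempotent. *)
Lemma ellis_numakura (E : topologicalType) (mul : E -> E -> E) (L : set E) :
  hausdorff_space E -> associative mul ->
  (forall b, continuous (mul^~ b)) -> compact L -> L !=set0 ->
  (forall a b, L a -> L b -> L (mul a b)) ->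
  exists2 u, L u & mul u u = u.
Proof.
move=> hE mulA mulc Lc L0 Lmul.
have Lcl : closed L by exact: compact_closed.
pose good (M : set E) := [/\ closed M, M `<=` L, M !=set0 &
  forall a b, M a -> M b -> M (mul a b)].
pose R (M N : {M | good M}) := `[< sval N `<=` sval M >].
have gL : good L by split.
have [|||[M gM] Mmin] := @ZL_preorder _ (exist _ L gL) R.
- by move=> M; exact/asboolP.
- by move=> M N P /asboolP MN /asboolP NP; apply/asboolP => x /NP/MN.
- move=> F Ftot; have [->|/set0P F0] := eqVneq F set0.
    by exists (exist _ L gL).
  have gI : good (\bigcap_(M in F) sval M).
    have LI : L `&` \bigcap_(M in F) sval M !=set0.
      apply: compact_meets_directed => //.
      - move=> M N FM FN; have [/asboolP MN|/asboolP MN] := Ftot M N FM FN.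
          by exists N => // x Nx; split=> //; exact: MN.
        by exists M => // x Nx; split=> //; exact: MN.
      - by move=> [M [? ? ? ?]].
      - by move=> [M [? ML [x Mx] ?]] _; exists x; split=> //; exact: ML.
    split.
    - by apply: closed_bigI => -[M []].
    - by have [N FN] := F0 => x /(_ _ FN); case: (svalP N) => _ + _ _; exact.
    - by have [x []] := LI; exists x.
    - move=> a b Ma Mb N FN; have := Ma N FN; have := Mb N FN.
      by case: (svalP N) => _ _ _ NM Nb Na; exact: NM.
  exists (exist _ _ gI) => N FN; apply/asboolP => x /=; exact.
have {}Mmin N : good N -> N `<=` M -> M `<=` N.
  move=> gN NM; have := Mmin (exist _ N gN).
  by move=> /(_ (introT (asboolP _) NM))/asboolP.
have [Mcl ML [a Ma] Mmul] := gM.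
have Mc : compact M by exact: (subclosed_compact Mcl Lc).
have gMa : good [set mul p a | p in M].
  split.
  - apply: compact_closed => //; apply: continuous_compact => //.
    by apply: continuous_subspaceT; exact: mulc.
  - by move=> _ [p Mp <-]; apply: ML; exact: Mmul.
  - by exists (mul a a); exists a.
  - move=> _ _ [p Mp <-] [q Mq <-]; exists (mul p (mul a q)).
      by apply: (Mmul) => //; exact: Mmul.
    by rewrite !mulA.
have [p Mp pa] : [set mul p a | p in M] a.
  by apply: (Mmin _ gMa) => // _ [p Mp <-]; exact: Mmul.
pose N := M `&` [set q | mul q a = a].
have gN : good N.
  split.
  - apply: closedI => //; apply: (@preimage_closed _ _ (mul^~ a) [set a]).
      by move=> x _; exact: mulc.
    by apply: accessible_closed_set1; exact: hausdorff_accessible.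
  - by move=> q [/ML].
  - by exists p.
  - move=> q r [Mq qa] [Mr ra]; split; first exact: Mmul.
    by rewrite /= -mulA ra.
have [|_ aa] := Mmin _ gN _ a Ma; first by move=> q [].
by exists a => //; exact: ML.
Qed.

Lemma ptws_cvgP (U : choiceType) (V : topologicalType)
    (F : set_system {ptws U -> V}) (f : {ptws U -> V}) : Filter F ->
  F --> f <-> forall t, (fun g : {ptws U -> V} => g t) @ F --> f t.
Proof.
move=> FF; split=> [Ff t|Ff].
  apply: cvg_trans; last exact: (@proj_continuous _ (fun _ : U => V) t f).
  exact: (@cvg_app _ _ _ _ (fun g : {ptws U -> V} => g t)).
apply/cvg_sup => i; apply/cvg_image.
  by rewrite predeqE => v; split=> // _; exists (fun=> v).
move=> A /Ff; rewrite /= => FA.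
exists ((fun g : {ptws U -> V} => g i) @^-1` A) => //.
by apply/seteqP; split=> [_ [g Ag <-]//|v Av]; exists (fun=> v).
Qed.

Lemma ptws_compr_continuous (U : choiceType) (V : topologicalType)
    (q : U -> U) :
  continuous (fun p : {ptws U -> V} => p \o q : {ptws U -> V}).
Proof.
move=> p; apply/ptws_cvgP => [|t]; first exact/fmap_filter/nbhs_filter.
exact: (@proj_continuous _ (fun _ : U => V) (q t) p).
Qed.

Lemma ptws_compl_continuous (U : choiceType) (V : topologicalType)
    (f : V -> V) :
  continuous f -> continuous (fun p : {ptws U -> V} => f \o p : {ptws U -> V}).
Proof.
move=> fc p; apply/ptws_cvgP => [|t]; first exact/fmap_filter/nbhs_filter.
apply: continuous_comp; last exact: fc.
exact: (@proj_continuous _ (fun _ : U => V) t p).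
Qed.

Lemma ultra_compact_cvg (I : Type) (X : topologicalType) (F : set_system I)
    (f : I -> X) (C : set X) : UltraFilter F -> compact C ->
  (\forall i \near F, C (f i)) -> exists2 x, C x & f @ F --> x.
Proof.
move=> FU Cc FC; have [x [Cx clx]] := Cc (f @ F) _ FC.
exists x => // A Ax; have [//|nFA] := in_ultra_setVsetC (f @^-1` A) FU.
by have [y [nAy Ay]] := clx (~` A) A nFA Ax.
Qed.

Section compact_orbit.
Variables (A : Type) (Z : topologicalType) (act : A -> Z -> Z) (H : set A).
Hypotheses (hZ : hausdorff_space Z)
  (act_cont : forall h, H h -> continuous (act h))
  (act_comp : forall g h, H g -> H h ->
    exists2 k, H k & act k =1 act g \o act h).

(** An idempotent [u] of the compact semigroup [L] takes the same value at [y] and at [u y]; being a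
    pointwise limit of elements of [H] at these two points, it makes them proximal. *)
Lemma proximal_in_compact (X : set Z) (x y : Z) :
  compact X -> (forall h z, H h -> X z -> X (act h z)) -> X x ->
  closure [set act h y | h in H] x -> exists2 x', X x' & proximal act H y x'.
Proof.
move=> Xc Xinv Xx clx; have Xcl : closed X by exact: compact_closed.
pose D := X `|` [set y].
pose E : topologicalType := {ptws Z -> Z}.
(* B leaves f free outside D: for q with values in X, f \o q = act h \o q. *)
pose B : set E := [set f | exists2 h, H h & forall z, D z -> f z = act h z].
pose L : set E := [set f | forall z, X (f z)] `&` closure B.
have evc z : continuous (fun f : E => f z).
  exact: (@proj_continuous _ (fun _ : Z => Z) z).
have Lc : compact L.
  apply: compact_closedI; last exact: closed_closure.
  exact: (@tychonoff _ (fun _ : Z => Z) (fun=> X)).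
have L0 : L !=set0.
  (* An ultrafilter containing the sets of [h] that take [y] near [x] has a limit at each point of
     [X] by compactness, and the limit sends [y] to [x]. Outside [D] the default value [x] keeps the
     limit in [X]. *)
  pose F := filter_from (nbhs x) (fun O => [set h | H h /\ O (act h y)]).
  have PF : ProperFilter F.
    apply: filter_from_proper.
      apply: filter_from_filter; first by exists setT; exact: filterT.
      move=> P Q Px Qx; exists (P `&` Q); first exact: filterI.
      by move=> h [Hh []].
    by move=> O /clx[_ [[h Hh <-] Oh]]; exists h.
  have [U [UU FU]] := ultraFilterLemma PF.
  have UH : U H by apply: FU; exists setT; [exact: filterT|move=> h []].
  have cvgX z : exists2 p, X p &
      (fun h => if pselect (D z) then act h z else x) @ U --> p.
    case: pselect => [[Xz|zy]|_] /=.
    - apply: ultra_compact_cvg => //; apply: filterS UH => h Hh; exact: Xinv.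
    - exists x => // O Ox; apply: FU; exists O => // h [_ Oh] /=.
      by rewrite zy.
    - by exists x => //; exact: cvg_cst.
  have [p pP] := choice (fun z => let: ex_intro2 p Xp cp := cvgX z in
    ex_intro _ p (conj Xp cp)).
  exists p; split; first by move=> z; have [] := pP z.
  pose phi h : E := fun z => if pselect (D z) then act h z else x.
  have phip : phi @ U --> (p : E).
    by apply/ptws_cvgP => t; have [] := pP t.
  move=> O /phip UO; have : U (H `&` phi @^-1` O) by exact: filterI.
  move=> /filter_ex[h [Hh Oh]].
  exists (phi h); split=> //; exists h => // z Dz.
  by rewrite /phi; case: pselect.
pose mul (p q : E) : E := p \o q.
have mulc q : continuous (mul^~ q).
  exact: ptws_compr_continuous.
have [||p q [Xp Bp] [Xq Bq]|u [Xu Bu] uu] := ellis_numakura _ _ mulc Lc L0.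
- exact: hausdorff_product.
- by [].
(* Left multiplication need not be continuous, so [p] is first approximated by some [f] in [B]; then
   [f \o q] equals [act h \o q], and [q] is approximated using continuity of [act h]. *)
- split; first by move=> z; exact: Xp.
  apply: closed_closure => O /mulc/Bp[f [[h Hh fh] Of]].
  exists (mul f q); split=> //.
  have -> : mul f q = act h \o q :> E.
    by apply/funext => z /=; rewrite /mul /= fh //; left; exact: Xq.
  have hc : continuous (fun g : E => act h \o g : E).
    by apply: ptws_compl_continuous; exact: act_cont.
  move=> O' /hc/Bq[g [[k Hk gk] O'g]]; exists (act h \o g : E); split=> //.
  have [l Hl lE] := act_comp Hh Hk.
  by exists l => // z Dz; rewrite lE /= gk.
exists (u y); first exact: Xu.
(* Indices of the net: a neighbourhood of [u y] with an [h] moving both [y] and [u y] into it,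
   ordered by shrinking the neighbourhood. *)
pose I := {Oh : set Z * A | [/\ nbhs (u y) Oh.1, H Oh.2, Oh.1 (act Oh.2 y) &
  Oh.1 (act Oh.2 (u y))]}.
have HI O : nbhs (u y) O -> exists i : I, (sval i).1 = O.
  move=> Oy; have uuy : u (u y) = u y by rewrite -[in RHS]uu.
  have [|f [[h Hh fh] [Oy1 Oy2]]] :=
      Bu ((fun f => f y) @^-1` O `&` (fun f => f (u y)) @^-1` O).
    apply: filterI; first exact: evc.
    by apply: evc; rewrite uuy.
  have fy : f y = act h y by apply: fh; right.
  have fuy : f (u y) = act h (u y) by apply: fh; left; exact: Xu.
  by unshelve eexists; first by exists (O, h); rewrite /= -fy -fuy; split.
exists I, (fun i j => (sval j).1 `<=` (sval i).1), (fun i => (sval i).2), (u y).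
split.
- split.
  + by have [i _] := HI setT filterT; exists.
  + by move=> i z.
  + by move=> i j k ij jk z /jk/ij.
  + move=> i j; have [|k kE] := HI ((sval i).1 `&` (sval j).1).
      by apply: filterI; [case: (svalP i)|case: (svalP j)].
    by exists k; rewrite kE; split=> z [].
- by move=> i; case: (svalP i).
- move=> O /HI[i iO]; exists i; rewrite /= iO => j; apply.
  by case: (svalP j).
- move=> O /HI[i iO]; exists i; rewrite /= iO => j; apply.
  by case: (svalP j).
Qed.
End compact_orbit.

Section equicontinuity_and_distality.
Variables (G : topologicalGroupType) (K : set G) (H : set (topAut G)).
Hypotheses (K_group : is_subgroup K) (K_closed : closed K)
  (H_group : is_subgroup H) (K_inv : invariant_set H K).
Local Notation pi := (left_coset K).
Local Notation act := (@coset_act G K).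

Lemma right_entourageP U x y : right_entourage U (pi x, pi y) <->
  exists2 u, U u & pi x = pi (u * y).
Proof.
have [K1 KM _] := K_group; split.
  have xx : prod_set [set x] K x by exists x => //; exists 1; rewrite ?mulg1.
  move=> /(_ x xx)[u Uu [_ [_ -> [k Kk <-]] /= <-]].
  by exists u => //; rewrite mulgA (left_cosetM K_group _ Kk).
move=> [u Uu /(congr1 (@coset_set G K)) /= xy] z /=.
rewrite xy => -[_ -> [k Kk <-]].
exists u => //; exists (y * k); last by rewrite mulgA.
by exists y => //; exists k.
Qed.

(** Let [h_i c] and [h_i d] tend to [z], with [c] near the trivial coset. Equicontinuity at the
    trivial coset, which [H] fixes, keeps [z] in [W]. Equicontinuity at [z], applied to the
    inverses, then brings [c] and [d] arbitrarily close to a common point [h_i^-1 z]. *)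
Lemma N_equicontinuous_distal : N_equicontinuous K H -> N_distal K H.
Proof.
have [H1 HM HV] := H_group.
move=> [W W1 Weq]; have {W1}/(nbhs_left_coset K_group) W1 := W1.
have [U U1 UW] := nbhs1_mul W1.
have [V V1 VU] := Weq _ (nbhs_singleton W1) _ (nbhs1_inv U1).
have W1' := (nbhs_left_coset K_group _ _).2 W1.
exists V => // c Vc [d dc [I [le [h [z [[_ lexx letr ledir] Hh hc hd]]]]]].
have Wz : W z.
  have [t zt] := left_cosetP z; rewrite zt in hc *.
  have [|i /(_ i (lexx i)) /=] := hc (pi @` [set x | U (t * x^-1)]).
    apply/(nbhs_left_coset K_group); apply: nbhs_lmul.
    apply: filterS (nbhs1_inv U1) => w Uw; exists (w * t) => //=.
    by rewrite invgM mulgA mulgV mul1g.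
  move=> [x /= Utx xc].
  have [y cy] := left_cosetP (act (h i) c).
  have := VU (h i) c (Hh i) Vc.
  rewrite (coset_act_pi K_group K_inv) ?aut_fun1 // -xc.
  move=> /right_entourageP[u Uu /coset_eqP-/(_ K_group)].
  rewrite invg1 mul1g => Kux.
  have -> : pi t = pi ((t * x^-1) * u^-1).
    apply/coset_eqP => //; rewrite !mulgA mulVg mul1g -invgM.
    by case: K_group => _ _; exact.
  exact: (UW _ _ Utx Uu).
apply: dc; apply: (coset_hausdorff K_group K_closed).
have [x cx] := left_cosetP c; have [y dy] := left_cosetP d.
have [t zt] := left_cosetP z.
move=> A B; rewrite {1}dy {1}cx => /(nbhs_left_coset K_group) Ay.
move=> /(nbhs_left_coset K_group) Bx.
have [V' V'z V'U] := Weq _ Wz _ (filterI (nbhs1_lmul Ay) (nbhs1_lmul Bx)).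
have [i hci] := hc _ V'z; have [j hdj] := hd _ V'z.
have [k [/hci/= V'c /hdj/= V'd]] := ledir i j.
have Hk := HV _ (Hh k).
exists (act (h k)^-1 z).
have := V'U _ _ Hk V'd; have := V'U _ _ Hk V'c.
rewrite !(coset_actKV K_group H_group K_inv) // zt.
rewrite (coset_act_pi K_group K_inv) // cx dy.
move=> /right_entourageP[u [_ Bu] ->].
by move=> /right_entourageP[v [Av _] uv]; split => //; rewrite uv.
Qed.

Lemma N_distal_recurrent : N_distal K H ->
  exists2 N : set (coset_space K), nbhs (left_coset K 1) N &
    forall x y, N x -> N y ->
      compact (closure (coset_orbit H x)) ->
      closure (coset_orbit H y) x -> closure (coset_orbit H x) y.
Proof.
move=> [W W1 Wd]; exists W => // x y Wx Wy cx yx.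
have [H1 HM HV] := H_group.
have hZ : hausdorff_space (coset_space K) by exact: coset_hausdorff.
have actC h : H h -> continuous (act h).
  exact: (coset_act_continuous K_group K_inv).
have actM g h : H g -> H h -> exists2 k, H k & act k =1 act g \o act h.
  move=> Hg Hh; exists (g * h); first exact: HM.
  by move=> c; rewrite /= (coset_actM K_group H_group K_inv).
have Xinv h d : H h -> closure (coset_orbit H x) d ->
    closure (coset_orbit H x) (act h d).
  exact: (closure_orbit_act K_group H_group K_inv).
have Xx : closure (coset_orbit H x) x.
  apply: subset_closure; exists 1 => //.
  exact: (coset_act1 K_group H_group K_inv).
have [x' Xx' yx'] := proximal_in_compact hZ actC actM cx Xinv Xx yx.
have [<-//|nyx] := pselect (x' = y).
by case: (Wd _ Wy); exists x'.
Qed.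
End equicontinuity_and_distality.

(** * Equicontinuously generated groups *)

(** The entourage at the point 1 of [G/{1}] bounds the inverse of [s w], hence the passage from [U]
    to its inverse. *)
Lemma equicontinuous_on1 (G : topologicalGroupType) (S : set (topAut G))
    (U : set G) : equicontinuous_on S -> nbhs (1 : G) U ->
  \forall w \near (1 : G), forall s, S s -> U (s w).
Proof.
move=> Seq /nbhs1_inv/(Seq 1)[W /(@left_coset_continuous _ _ 1) Wc WU].
have {Wc} W1 : nbhs (1 : G) (left_coset [set (1 : G)] @^-1` W) by exact: Wc.
have g1 : is_subgroup [set (1 : G)].
  by split=> // [x y -> ->|x ->]; rewrite ?mulg1 ?invg1.
have aE s x : coset_act s (left_coset [set (1 : G)] x) = left_coset _ (s x).
  by rewrite coset_actE // image_set1 aut_fun1.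
move: W1; apply: filterS => w Ww s Ss.
have := WU s _ Ss Ww; rewrite !aE aut_fun1 => /(right_entourageP g1)[u Uu].
move=> /coset_eqP-/(_ g1); rewrite invg1 mul1g /= => us.
by rewrite -(invgK (s w)) -[(s w)^-1]mul1g -us mulgK.
Qed.

Section generated_action.
Variables (G : topologicalGroupType) (S : set (topAut G)).
Hypotheses (S_inv : inv_set S = S) (S_eq : equicontinuous_on S).
Local Notation H := (generated S).
Implicit Types P : set G.

Lemma generatorV s : S s -> S s^-1.
Proof. by move=> Ss; rewrite -S_inv; exists s. Qed.

Lemma sub_generated : S `<=` H.
Proof. by move=> s Ss A [_]; exact. Qed.

Lemma generated_group : is_subgroup H.
Proof.
split=> [A [[]]//|g h Hg Hh A gA|g Hg A gA].
  by have [[_ AM _] _] := gA; apply: AM; [exact: Hg|exact: Hh].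
by have [[_ _ AV] _] := gA; apply: AV; exact: Hg.
Qed.

(** Symmetry of [S] turns the one-sided hypothesis into an equivalence for each generator, and the
    maps satisfying it form a subgroup. *)
Lemma generated_stable P h x : (forall s y, S s -> P y -> P (s y)) ->
  H h -> P (h x) <-> P x.
Proof.
move=> SP Hh; pose M := [set g : topAut G | forall y, P (g y) <-> P y].
suff : M h by exact.
apply: Hh; split; last first.
  move=> s Ss y; split; last exact: SP.
  by move=> /(SP _ _ (generatorV Ss)); rewrite aut_mulKV.
split=> // [g k Mg Mk y|g Mg y].
  by rewrite topAutME; split=> [/Mg/Mk|/Mk/Mg].
by rewrite -(Mg (g^-1 y)) aut_mulVK.
Qed.

(** Since [h(g) x = h(g h^-1(x))], the stabilizer of a set preserved by [H] in both directions is
    itself preserved. *)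
Lemma stabilizer_invariant P : left_stable P ->
  (forall s y, S s -> P y -> P (s y)) ->
  open_invariant_subgroups H (stabilizer P).
Proof.
move=> Pst SP; split; [exact: stabilizer_subgroup|exact: stabilizer_open|].
have PH h y : H h -> P (h y) <-> P y by exact: generated_stable.
have sH h g : H h -> stabilizer P g -> stabilizer P (h g).
  move=> Hh Pg x; rewrite -{1}(aut_mulVK h x) -aut_funM.
  have [_ _ HV] := generated_group; have HhV := HV _ Hh.
  by split=> [/(PH _ _ Hh)/Pg/(PH _ _ HhV)|/(PH _ _ HhV)/Pg/(PH _ _ Hh)].
move=> h Hh; apply/seteqP; split=> [_ [g Pg <-]|g Pg]; first exact: sH.
exists (h^-1 g); last exact: aut_mulVK.
by apply: sH => //; have [_ _ HV] := generated_group; exact: HV.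
Qed.

(** [iter n core P] consists of the points that all words of length at most [n] in [S] keep in [P];
    dually, [iter n hull P] consists of those that some such word carries into [P]. *)
Definition core P := [set x | P x /\ forall s, S s -> P (s x)].

Definition hull P := [set x | P x \/ exists2 s, S s & P (s x)].

Lemma near1_generators P : left_stable P ->
  \forall w \near (1 : G), forall s x, S s -> P (s x) -> P (s (w * x)).
Proof.
move=> /(equicontinuous_on1 S_eq); apply: filterS => w Pw s x Ss Psx.
by rewrite aut_funM; exact: Pw.
Qed.

Lemma core_stable P : left_stable P -> left_stable (core P).
Proof.
move=> Pst; have := near1_generators Pst; move: Pst; rewrite /left_stable.
apply: filterS2 => w Pw Psw x [/Pw Px Psx]; split=> // s Ss.
by apply: Psw => //; exact: Psx.
Qed.

Lemma hull_stable P : left_stable P -> left_stable (hull P).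
Proof.
move=> Pst; have := near1_generators Pst; move: Pst; rewrite /left_stable.
apply: filterS2 => w Pw Psw x [/Pw|[s Ss Psx]]; first by left.
by right; exists s => //; exact: Psw.
Qed.

Lemma hullS P Q : P `<=` Q -> hull P `<=` hull Q.
Proof. by move=> PQ x [/PQ|[s Ss /PQ]]; [left|right; exists s]. Qed.

Lemma hull_core P : hull (core P) `<=` P.
Proof.
move=> x [[]//|[s Ss [_ /(_ _ (generatorV Ss))]]].
by rewrite aut_mulKV.
Qed.

Lemma iter_core_stable n P : left_stable P -> left_stable (iter n core P).
Proof. by move=> Pst; elim: n => //= n; exact: core_stable. Qed.

Lemma iter_hull_stable n P : left_stable P -> left_stable (iter n hull P).
Proof. by move=> Pst; elim: n => //= n; exact: hull_stable. Qed.

Lemma iter_core_sub m n P : (m <= n)%N -> iter n core P `<=` iter m core P.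
Proof.
elim: n => [|n IH]; first by rewrite leqn0 => /eqP->.
by rewrite leq_eqVlt => /orP[/eqP->//|mn] x [/(IH mn)].
Qed.

Lemma iter_hullS n P Q : P `<=` Q -> iter n hull P `<=` iter n hull Q.
Proof. by move=> PQ; elim: n => //= n; exact: hullS. Qed.

(** The innermost [hull] and the outermost [core] cancel by [hull_core]. These decreasing sets feed
    the compactness argument in [core_stationary]. *)
Lemma iter_hull_core_sub m n P : (m <= n)%N ->
  iter n hull (iter n core P) `<=` iter m hull (iter m core P).
Proof.
elim: n => [|n IH]; first by rewrite leqn0 => /eqP->.
rewrite leq_eqVlt => /orP[/eqP->//|mn] x; rewrite iterSr => Px.
by apply: (IH mn); apply: iter_hullS Px => y /=; exact: hull_core.
Qed.

Lemma iter_hull_orbit n P x : iter n hull P x -> exists2 h, H h & P (h x).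
Proof.
have [H1 HM _] := generated_group.
elim: n x => [|n IH] x /=; first by exists 1.
move=> [/IH//|[s Ss /IH[h Hh Phsx]]]; exists (h * s) => //.
by apply: HM => //; exact: sub_generated.
Qed.

(** A word of length [n] leads from [x] to a point [z] one generator away from leaving [P], and the
    inverse word brings [z] back to [Q]. Enlarging [Q] to [hull Q] in the induction records this
    return path. *)
Lemma iter_core_escape n P Q x : Q x -> iter n core P x ->
  ~ iter n.+1 core P x ->
  exists2 z, (P `\` core P) z & iter n hull Q z.
Proof.
elim: n Q x => [|n IH] Q x Qx Px nPx; first by exists x.
have [s Ss nPsx] : exists2 s, S s & ~ iter n.+1 core P (s x).
  apply: contrapT => /forall2NP nE; apply: nPx; split=> // s Ss.
  by case: (nE s) => [//|/contrapT].
have [||z zP Qz] := IH (hull Q) (s x) _ _ nPsx.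
- by right; exists s^-1; [exact: generatorV|rewrite aut_mulKV].
- by case: Px => _; exact.
by exists z; rewrite // iterSr.
Qed.

Section coset_dynamics.
Variable K : set G.
Hypotheses (K_group : is_subgroup K) (K_inv : invariant_set H K).
Local Notation pi := (left_coset K).

Lemma core_right_invariant P :
  right_invariant K P -> right_invariant K (core P).
Proof.
move=> Pr x k Kk [Px Psx]; split; first exact: Pr.
move=> s Ss; rewrite aut_funM; apply: Pr; last exact: Psx.
by apply: (invariantP K_inv) => //; exact: sub_generated.
Qed.

Lemma hull_right_invariant P :
  right_invariant K P -> right_invariant K (hull P).
Proof.
move=> Pr x k Kk [Px|[s Ss Psx]]; first by left; exact: Pr.
right; exists s; rewrite // aut_funM; apply: Pr => //.
by apply: (invariantP K_inv) => //; exact: sub_generated.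
Qed.

Lemma iter_core_right_invariant n P :
  right_invariant K P -> right_invariant K (iter n core P).
Proof. by move=> Pr; elim: n => //= n; exact: core_right_invariant. Qed.

Lemma iter_hull_right_invariant n P :
  right_invariant K P -> right_invariant K (iter n hull P).
Proof. by move=> Pr; elim: n => //= n; exact: hull_right_invariant. Qed.

Lemma core_stationary (U : set G) : is_subgroup U -> open U -> compact U ->
  (forall x y, (pi @` U) x -> (pi @` U) y ->
    compact (closure (coset_orbit H x)) ->
    closure (coset_orbit H y) x -> closure (coset_orbit H x) y) ->
  exists n, iter n core (prod_set U K) `<=` iter n.+1 core (prod_set U K).
Proof.
move=> U_group Uo Uc rec; apply: contrapT => /forallNP nstat.
set P := prod_set U K in nstat *.
have P_st : left_stable P by exact: prod_set_stable.
have Pr : right_invariant K P by exact: prod_set_right_invariant.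
have PU x : P x -> exists2 u, U u & exists2 k, K k & x = u * k.
  by move=> [u Uu [k Kk <-]]; exists u => //; exists k.
have core_cl n : closed (iter n core P).
  by apply: left_stable_closed; exact: iter_core_stable.
have piP : pi @` P = pi @` U by exact: image_prod_set.
have pc : compact (pi @` U).
  apply: continuous_compact => //; apply: continuous_subspaceT.
  exact: left_coset_continuous.
have pcl n : closed (pi @` iter n core P).
  by apply: right_invariant_closed => //; exact: iter_core_right_invariant.
(* Points one generator away from leaving [P] that some word of length at most [n] carries into the
   [n]-th iterate. These sets are closed and decreasing, so compactness of [U] yields a common point
   [z]. *)
pose Z n := (P `\` core P) `&` iter n hull (iter n core P).
have Zr n : right_invariant K (Z n).
  move=> x k Kk [[Px nPx] Zx]; split; last first.
    by apply: iter_hull_right_invariant => //; exact: iter_core_right_invariant.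
  split; first exact: Pr.
  move=> cxk; apply: nPx; rewrite -(mulgK k x).
  apply: core_right_invariant => //.
  by have [_ _] := K_group; exact.
have [z [Uz Zz]] : U `&` \bigcap_(n in setT) Z n !=set0.
  apply: compact_meets_directed => //.
  - move=> m n _ _; exists (maxn m n) => // x [Px Hx]; split; split=> //.
      by apply: iter_hull_core_sub Hx; exact: leq_maxl.
    by apply: iter_hull_core_sub Hx; exact: leq_maxr.
  - move=> n _; apply: left_stable_closed; apply: left_stableI.
      by apply: left_stableI => //; apply: left_stableC; exact: core_stable.
    by apply: iter_hull_stable; exact: iter_core_stable.
  (* The escape point lies in [U K], and right invariance of [Z n] allows its factor in [K] to be
     removed. *)
  - move=> n _; have /existsNP[x /not_implyP[Px nPx]] := nstat n.
    have [z zP Qz] := iter_core_escape Px Px nPx.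
    have [u Uu [k Kk zE]] := PU z zP.1.
    exists u; split=> //; rewrite -(mulgK k u) -zE.
    by apply: Zr; [have [_ _] := K_group; exact|].
have Pz : P z by have [[]] := Zz 0%N I.
have ncz : ~ core P z by have [[]] := Zz 0%N I.
(* Compactness again, now in [G/K]: the orbit of [pi z] meets the image of every iterate, so its
   closure meets all of them at one point. *)
have [c [cU /= cc]] : pi @` U `&` \bigcap_(n in setT)
    (closure (coset_orbit H (pi z)) `&` pi @` iter n core P) !=set0.
  apply: compact_meets_directed => //.
  - move=> m n _ _; exists (maxn m n) => // x [zx [y Py yx]]; split; split=> //.
      by exists y => //; apply: iter_core_sub Py; exact: leq_maxl.
    by exists y => //; apply: iter_core_sub Py; exact: leq_maxr.
  - move=> n _; apply: closedI => //; exact: closed_closure.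
  - move=> n _; have [_ /iter_hull_orbit[h Hh Phz]] := Zz n I.
    exists (pi (h z)); split.
      by rewrite -piP; exists (h z) => //; exact: (iter_core_sub (leq0n n) Phz).
    split; last by exists (h z).
    apply: subset_closure; exists h => //.
    exact: (coset_act_pi K_group K_inv).
have Ac n : (pi @` iter n core P) c by have [] := cc n I.
have cP h n : H h -> (pi @` iter n core P) (coset_act h c).
  move=> Hh; have [x cx] := left_cosetP c; rewrite cx in Ac *.
  rewrite (coset_act_pi K_group K_inv) //; apply: imageP.
  (* [S] preserves this intersection, because membership in iterate [m.+1] puts the images under [S]
     in iterate [m]. *)
  pose A := \bigcap_(m in setT) iter m core P.
  suff : A (h x) by apply.
  have Ax : A x.
    move=> m _; apply/right_invariant_image; [exact: K_group| |exact: Ac].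
    exact: iter_core_right_invariant.
  apply/generated_stable; [|exact: Hh|exact: Ax].
  by move=> s y Ss Ay m _; have [_] := Ay m.+1 I; exact.
have ccl n : closure (coset_orbit H c) `<=` pi @` iter n core P.
  by apply: subset_closure_orbit => // h Hh; exact: cP.
have cpt : compact (closure (coset_orbit H c)).
  apply: (subclosed_compact _ pc); first exact: closed_closure.
  by rewrite -piP; exact: (ccl 0%N).
have /(ccl 1%N) : closure (coset_orbit H c) (pi z).
  by apply: rec => //; have [] := cc 0%N I.
move=> /right_invariant_image-/(_ K_group (core_right_invariant Pr)).
exact: ncz.
Qed.

Lemma stationary_core_invariant n P : iter n core P `<=` iter n.+1 core P ->
  forall s y, S s -> iter n core P y -> iter n core P (s y).
Proof. by move=> st s y Ss /st[_]; exact. Qed.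

End coset_dynamics.
End generated_action.

(** * Open invariant subgroups and the discrete residual *)

Section residual.
Variables (G : topologicalGroupType) (S : set (topAut G)).
Hypotheses (hG : hausdorff_space G) (tdG : totally_disconnected [set: G])
  (lcG : locally_compact [set: G]).
Hypotheses (S_inv : inv_set S = S) (S_eq : equicontinuous_on S).
Local Notation H := (generated S).
Local Notation R := (Res H).

Lemma Res_subgroup : is_subgroup R.
Proof.
split=> [V [[]]//|x y Rx Ry V HV|x Rx V HV]; have [[_ VM VV] _ _] := HV.
  by apply: VM; [exact: Rx|exact: Ry].
by apply: VV; exact: Rx.
Qed.

Lemma Res_invariant h x : H h -> R x -> R (h x).
Proof.
move=> Hh Rx V HV; have [_ _ V_inv] := HV.
by apply: (invariantP V_inv Hh); exact: Rx.
Qed.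

Lemma open_invariant_setI : setI_closed (open_invariant_subgroups H).
Proof.
move=> V W [[V1 VM VV] Vo Vi] [[W1 WM WV] Wo Wi]; split; last 2 first.
- exact: openI.
- move=> h Hh; apply/seteqP; split=> [_ [x [Vx Wx] <-]|x [Vx Wx]].
    by split; [exact: (invariantP Vi)|exact: (invariantP Wi)].
  have [_ _ HV] := generated_group S; have HhV := HV _ Hh.
  exists (h^-1 x); last exact: aut_mulVK.
  by split; [exact: (invariantP Vi)|exact: (invariantP Wi)].
by split=> // [x y [? ?] [? ?]|x [? ?]]; split; auto.
Qed.

(** Take [U'] with [s(U')] inside [U] for all generators [s]. Compactness gives [V] whose part in
    [U] lies in [U' R]; then [P], the product of that part with [R], is preserved by [S], and its
    stabilizer lies in [U R]. *)
Lemma Res_base U : is_subgroup U -> open U -> compact U ->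
  exists2 V, open_invariant_subgroups H V & V `<=` prod_set U R.
Proof.
move=> U_group Uo Uc; have [U1 UM UV] := U_group.
have nU : nbhs (1 : G) U by exact: open_nbhs_nbhs.
have [U' [U'_group U'o _ U'U]] :=
  van_dantzig hG tdG lcG (equicontinuous_on1 S_eq nU).
have [R1 RM RV] := Res_subgroup.
have [|||||V V_inv UVU'] := @compact_directed_sub_open _ _
    (open_invariant_subgroups H) id U (prod_set U' R) Uc.
- by apply: left_stable_open; exact: prod_set_stable.
- exists setT; split=> //; first exact: openT.
  move=> h Hh; apply/seteqP; split=> // x _; exists (h^-1 x) => //.
  exact: aut_mulVK.
- move=> V W HV HW; exists (V `&` W) => //; exact: open_invariant_setI.
- move=> V [V_group Vo _]; apply: left_stable_closed.
  apply: subgroup_stable => //.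
  by apply: open_nbhs_nbhs; split=> //; case: V_group.
- move=> x [_ Rx]; exists 1; first by case: U'_group.
  by exists x; rewrite ?mul1g.
have [V_group Vo Vi] := V_inv; have [V1 VM VV] := V_group.
pose P := prod_set (V `&` U) R.
exists (stabilizer P).
  apply: stabilizer_invariant => //.
    apply: prod_set_stable; last exact: openI.
    by split=> // [x y [? ?] [? ?]|x [? ?]]; split; auto.
  move=> s _ Ss [v [Vv Uv] [r Rr <-]].
  have Hs : H s by exact: sub_generated.
  (* [u'] differs from [v] by an element of [R], which lies in [V]; so [u'] is still in [V], while
     [s u'] lies in [U]. *)
  have [u' U'u' [r' Rr' vE]] := UVU' v (conj Uv Vv).
  have Vu' : V u'.
    rewrite -(mulgK r' u') vE; apply: VM => //; apply: VV; exact: Rr'.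
  exists (s u'); first by split; [exact: (invariantP Vi)|exact: U'U].
  exists (s (r' * r)); first by apply: Res_invariant => //; exact: RM.
  by rewrite -aut_funM mulgA vE.
have P1 : P 1 by exists 1; [split|exists 1; rewrite ?mulg1].
by move=> x /(stabilizer_sub P1)[v [_ Uv] [r Rr <-]]; exists v => //; exists r.
Qed.

(** For [x] in [V0], every [s x] is [u0 r0] with [u0] in the compact [U0], so a single [U2] has all
    its conjugates by such [u0] inside [U]. If [y = x v] with [v] in [V], then [r0 s(v) r0^-1] stays
    in [V], hence in [U2 R]. *)
Lemma Res_sub_N_equicontinuous (K : set G) : is_subgroup K ->
  invariant_set H K -> R `<=` K -> N_equicontinuous K H.
Proof.
move=> K_group K_inv RK.
have [U0 [U0_group U0o U0c _]] :=
  van_dantzig hG tdG lcG (@filterT _ (nbhs 1) _).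
have [V0 [[V01 _ _] V0o V0i] V0U0] := Res_base U0_group U0o U0c.
exists (left_coset K @` V0).
  apply: open_nbhs_nbhs; split; first exact: left_coset_open.
  by exists 1.
move=> _ [x V0x <-] U U1.
have [U2 [U2_group U2o U2c U2U]] :=
  van_dantzig hG tdG lcG (compact_nbhs1_conj U0c U1).
have [V [[V1 VM VV] Vo Vi] VU2] := Res_base U2_group U2o U2c.
exists (left_coset K @` [set y | V (x^-1 * y)]).
  apply/(nbhs_left_coset K_group); apply: nbhs_rmul.
  have : nbhs (1 : G) V by exact: open_nbhs_nbhs.
  by apply: filterS => v Vv; exists (x * v) => //=; rewrite mulKg.
move=> s _ Hs [y /= Vxy <-]; rewrite !(coset_act_pi K_group K_inv) //.
apply/right_entourageP => //.
have [u0 U0u0 [r0 Rr0 sx]] := V0U0 _ (invariantP V0i Hs V0x).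
have [R1 RM RV] := Res_subgroup.
have RV' : R `<=` V by move=> r; apply.
have [|u Uu [r Rr uE]] := VU2 (r0 * s (x^-1 * y) * r0^-1).
  apply: (VM); last by apply: VV; exact: RV'.
  by apply: VM; [exact: RV'|exact: (invariantP Vi)].
(* [s x] and [s y] lie in [u0 K] and [u0 u K], so this conjugate of [u^-1] carries the second coset
   to the first. *)
exists (u0 * u^-1 * u0^-1).
  by apply: U2U => //; case: U2_group => _ _; exact.
have -> : s y = u0 * (u * r) * r0.
  rewrite uE -[in LHS](mulVKg x y) aut_funM -sx.
  by rewrite !mulgA -[_ * r0^-1 * r0]mulgA mulVg mulg1.
rewrite -sx !mulgA -[_ * u0^-1 * u0]mulgA mulVg mulg1.
rewrite -[_ * u^-1 * u]mulgA mulVg mulg1 -mulgA.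
rewrite (left_cosetM K_group _ (RK _ Rr0)).
by rewrite (left_cosetM K_group _ (RK _ (RM _ _ Rr Rr0))).
Qed.
End residual.

(** * Neighbourhood bases of the trivial coset *)

Section base.
Variables (G : topologicalGroupType) (H : set (topAut G)) (K : set G).
Hypotheses (K_group : is_subgroup K) (K_closed : closed K).

Local Notation base := [set [set left_coset K x | x in prod_set V K] |
  V in open_invariant_subgroups H].

(** The coset of a point of [Res H] belongs to every member of the base, while points of the
    Hausdorff space [G/K] are closed. *)
Lemma nbhs_base_Res : nbhs_base (left_coset K 1) base -> Res H `<=` K.
Proof.
move=> [_ Wbase] x Rx; apply: contrapT => nKx.
have neq : left_coset K 1 != left_coset K x.
  by apply/eqP => /coset_eqP-/(_ K_group); rewrite invg1 mul1g.
have x_cl : closed [set left_coset K x].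
  apply: accessible_closed_set1; apply: hausdorff_accessible.
  exact: coset_hausdorff.
have [|_ [V HV <-] VKW] := Wbase (~` [set left_coset K x]).
  apply: open_nbhs_nbhs; split; first exact: closed_openC.
  by move/eqP : neq.
apply: (VKW (left_coset K x)) => //; rewrite image_prod_set //.
by exists x => //; exact: Rx.
Qed.

Lemma nbhs_baseI :
  (forall U, nbhs (1 : G) U ->
    exists2 V, open_invariant_subgroups H V & V `<=` prod_set U K) ->
  nbhs_base (left_coset K 1) base.
Proof.
move=> HU; split=> [_ [V [[V1 _ _] Vo _] <-]|W /(nbhs_left_coset K_group)/HU].
  rewrite image_prod_set //; apply: open_nbhs_nbhs.
  by split; [exact: left_coset_open|exists 1].
move=> [V HV VW]; exists [set left_coset K x | x in prod_set V K].
  by exists V.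
rewrite image_prod_set // => _ [x /VW[u Wu [k Kk <-]] <-].
by rewrite left_cosetM.
Qed.
End base.

Lemma recurrent_nbhs_base (G : topologicalGroupType) (S : set (topAut G))
    (K : set G) : hausdorff_space G -> totally_disconnected [set: G] ->
  locally_compact [set: G] -> inv_set S = S -> equicontinuous_on S ->
  is_subgroup K -> closed K -> invariant_set (generated S) K ->
  (exists2 N : set (coset_space K), nbhs (left_coset K 1) N &
    forall x y, N x -> N y ->
      compact (closure (coset_orbit (generated S) x)) ->
      closure (coset_orbit (generated S) y) x ->
      closure (coset_orbit (generated S) x) y) ->
  nbhs_base (left_coset K 1)
    [set [set left_coset K x | x in prod_set V K] |
       V in open_invariant_subgroups (generated S)].
Proof.
move=> hG tdG lcG S_inv S_eq K_group K_closed K_inv [N N1 Nrec].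
have {}N1 := (nbhs_left_coset K_group _ _).1 N1.
apply: nbhs_baseI => // W W1.
have [U [U_group Uo Uc UNW]] := van_dantzig hG tdG lcG (filterI N1 W1).
have [|n stat] := core_stationary S_inv S_eq K_group K_inv U_group Uo Uc.
  by move=> _ _ [x /UNW[Nx _] <-] [y /UNW[Ny _] <-]; exact: Nrec.
set P := iter n (core S) _ in stat.
exists (stabilizer P).
  apply: stabilizer_invariant => //.
    by apply: iter_core_stable => //; exact: prod_set_stable.
  exact: stationary_core_invariant.
(* Automorphisms fix 1, so it survives every [core]; this places the stabilizer inside [P]. *)
have P1 : P 1.
  rewrite /P; elim: (n) => [|m IH] /=; last first.
    by split=> // s _; rewrite aut_fun1.
  by exists 1; [case: U_group|exists 1; [case: K_group|rewrite mulg1]].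
move=> x /(stabilizer_sub P1)/(iter_core_sub (leq0n n))[u /UNW[_ Wu] Kx].
by exists u.
Qed.

Theorem theorem1 (G : topologicalGroupType) (H : set (topAut G)) (K : set G)
  (G_hausdorff : hausdorff_space G)
  (G_td : totally_disconnected [set: G])
  (G_lc : locally_compact [set: G])
  (H_group : is_subgroup H)
  (H_gen : equicontinuously_generated H)
  (K_group : is_subgroup K)
  (K_closed : closed K)
  (K_inv : invariant_set H K) :
  [<->
    (* (i) *) N_equicontinuous K H;
    (* (ii) *) N_distal K H;
    (* (iii) *)
    exists2 N : set (coset_space K), nbhs (left_coset K 1) N &
      forall x y, N x -> N y ->
        compact (closure (coset_orbit H x)) ->
        closure (coset_orbit H y) x -> closure (coset_orbit H x) y;
    (* (iv) *)
    nbhs_base (left_coset K 1)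
      [set [set left_coset K x | x in prod_set V K] |
         V in open_invariant_subgroups H];
    (* (v) *) Res H `<=` K].
Proof.
have [S [S_inv S_eq HE]] := H_gen; subst H; tfae.
- exact: N_equicontinuous_distal.
- exact: N_distal_recurrent.
- exact: recurrent_nbhs_base.
- exact: nbhs_base_Res.
- exact: Res_sub_N_equicontinuous.
Qed.
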